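(* Let $\mu\in[\mu_0,\delta^{-1}]$. If $(\varsigma_\mu,\sigma_\mu)\in\mathcal S_\mu^+$ is a critical point of $P_\mu^d$, then the vector $$x_\mu=G_\mu(\varsigma_\mu,\sigma_\mu)^{-1}(f-\sigma_\mu b)$$ is a global minimizer of $P_\mu$ over $\mathcal X_\mu$, $(\varsigma_\mu,\sigma_\mu)$ is a global maximizer of $P_\mu^d$ over $\mathcal S_\mu^+$, and $$\min_{x\in\mathcal X_\mu}P_\mu(x)=P_\mu(x_\mu)=P_\mu^d(\varsigma_\mu,\sigma_\mu)=\max_{(\varsigma,\sigma)\in\mathcal S_\mu^+}P_\mu^d(\varsigma,\sigma).$$
   Context: Data: $n,m\ge 1$; $B\in\mathbb R^{m\times n}$; $Q\in\mathbb R^{n\times n}$ symmetric; $H\in\mathbb R^{n\times n}$ (symmetric) negative definite; $\lambda\in\mathbb R$, $\lambda>0$; $f,b\in\mathbb R^n$. $|\cdot|$ is the Euclidean norm. Define $$g(x)=\tfrac12\left(\tfrac12|Bx|^2-\lambda\right)^2,\qquad h(x)=\tfrac12x^THx-b^Tx,\qquad x\in\mathbb R^n .$$ Assume $h(H^{-1}b)>0$, define $\mu_0>0$ by $\mu_0^{-1}=h(H^{-1}b)$, and fix $\delta\in(0,\mu_0^{-1}]$. For $\mu\in[\mu_0,\delta^{-1}]$ let $$\mathcal X_\mu=\{x\in\mathbb R^n: h(x)\ge\mu^{-1}\},\qquad P_\mu(x)=\tfrac12x^TQx-f^Tx+\mu g(x),$$ $$G_\mu(\varsigma,\sigma)=Q+\mu\varsigma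 B^TB-\sigma H,\qquad \mathcal S_\mu^+=\{(\varsigma,\sigma)\in\mathbb R^2:\varsigma\ge-\lambda,\ \sigma\ge0,\ G_\mu(\varsigma,\sigma)\succ0\},$$ where $\succ0$ means positive definite, and let $$P_\mu^d(\varsigma,\sigma)=-\tfrac12(f-\sigma b)^TG_\mu(\varsigma,\sigma)^{-1}(f-\sigma b)-\mu\lambda\varsigma-\tfrac{\mu}{2}\varsigma^2+\tfrac{\sigma}{\mu}.$$ This formula is smooth on the open set of $(\varsigma,\sigma)\in\mathbb R^2$ where $G_\mu(\varsigma,\sigma)$ is invertible, which contains $\mathcal S_\mu^+$. A critical point of $P_\mu^d$ over $\mathcal S_\mu^+$ is a point of $\mathcal S_\mu^+$ at which both partial derivatives $\partial P_\mu^d/\partial\varsigma$ and $\partial P_\mu^d/\partial\sigma$ vanish. *)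

(* Defs.v *)
(* R is an arbitrary realType; vectors of R^n are columns. *)
From mathcomp Require Import all_boot all_order all_algebra sesquilinear.
From mathcomp Require Import classical_sets reals topology normedtype derive.

Set Implicit Arguments.
Unset Strict Implicit.
Unset Printing Implicit Defensive.

Import Order.TTheory GRing.Theory Num.Theory.
Import numFieldNormedType.Exports.

Local Open Scope classical_set_scope.
Local Open Scope ring_scope.

Section Generic.
Context {R : realType}.

Definition dotv n (u v : 'cV[R]_n) : R := (u^T *m v) 0 0.

Definition quadf n (A : 'M[R]_n) (x : 'cV[R]_n) : R := dotv x (A *m x).

(* The library norm `|x| on matrices is the sup norm. *)
Definition enorm n (x : 'cV[R]_n) : R := Num.sqrt (\sum_i x i 0 ^+ 2).

(* Symmetry is not part of definiteness here. *)
Definition posdef n (A : 'M[R]_n) : Prop :=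
  forall x : 'cV[R]_n, x != 0 -> 0 < quadf A x.

Definition negdef n (A : 'M[R]_n) : Prop :=
  forall x : 'cV[R]_n, x != 0 -> quadf A x < 0.

Definition global_minimizer T (F : T -> R) (A : set T) (x : T) : Prop :=
  A x /\ forall y, A y -> F x <= F y.

Definition global_maximizer T (F : T -> R) (A : set T) (x : T) : Prop :=
  A x /\ forall y, A y -> F y <= F x.

Definition is_min_value T (F : T -> R) (A : set T) (v : R) : Prop :=
  (F @` A) v /\ lbound (F @` A) v.

Definition is_max_value T (F : T -> R) (A : set T) (v : R) : Prop :=
  (F @` A) v /\ ubound (F @` A) v.

(* [is_derive] asserts both that the two-sided derivative exists and that it
   has the given value, whereas 'D_v f is total with a default value. *)
Definition critical_point_over (F : R * R -> R) (S : set (R * R))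
    (p : R * R) : Prop :=
  [/\ S p,
      is_derive p.1 (1 : R) (fun s : R => F (s, p.2)) 0 &
      is_derive p.2 (1 : R) (fun t : R => F (p.1, t)) 0].

End Generic.

Section Problem.
Context {R : realType} (n m : nat).
Variables (B : 'M[R]_(m, n)) (Q H : 'M[R]_n) (lambda : R) (f b : 'cV[R]_n).

Definition gfun (x : 'cV[R]_n) : R :=
  2^-1 * (2^-1 * enorm (B *m x) ^+ 2 - lambda) ^+ 2.

Definition hfun (x : 'cV[R]_n) : R := 2^-1 * quadf H x - dotv b x.

Definition mu_zero : R := (hfun (invmx H *m b))^-1.

Definition feasible (mu : R) : set 'cV[R]_n := [set x | mu^-1 <= hfun x].

Definition primal (mu : R) (x : 'cV[R]_n) : R :=
  2^-1 * quadf Q x - dotv f x + mu * gfun x.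

Definition Gmx (mu : R) (p : R * R) : 'M[R]_n :=
  Q + (mu * p.1) *: (B^T *m B) - p.2 *: H.

Definition dual_feasible (mu : R) : set (R * R) :=
  [set p | [/\ - lambda <= p.1, 0 <= p.2 & posdef (Gmx mu p)]].

(* [invmx] is the identity on singular matrices, so this agrees with the
   intended formula exactly where [Gmx mu p] is invertible; that set is open
   and contains [dual_feasible mu]. *)
Definition dual (mu : R) (p : R * R) : R :=
  - (2^-1 * quadf (invmx (Gmx mu p)) (f - p.2 *: b))
  - mu * lambda * p.1 - mu / 2 * p.1 ^+ 2 + p.2 / mu.

Definition dual_to_primal (mu : R) (p : R * R) : 'cV[R]_n :=
  invmx (Gmx mu p) *m (f - p.2 *: b).

End Problem.

(* Main.v *)
Require Import Defs.
From mathcomp Require Import all_boot all_order all_algebra sesquilinear.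
From mathcomp Require Import ring lra.
From mathcomp Require Import classical_sets reals topology normedtype derive.

Set Implicit Arguments.
Unset Strict Implicit.
Unset Printing Implicit Defensive.

Import Order.TTheory GRing.Theory Num.Theory.
Import numFieldNormedType.Exports.
Local Open Scope ring_scope.

(* Write Xi(x, p) for the Lagrangian in which mu g(x) is replaced by its
   Legendre transform, so that P(x) dominates Xi(x, p) for feasible x, and let
   x_p = G(p)^-1 (f - sigma b). Completing the square shows that Pd(p) is the
   minimum over x of Xi(x, p), attained at x_p; this is weak duality. At a
   critical point the partial derivatives of Pd are those of Xi(x_p, .), and
   their vanishing says h(x_p) = 1/mu and varsigma = |B x_p|^2/2 - lambda, so
   Xi(x_p, p) = P(x_p) and there is no duality gap. The derivatives need no
   calculus of matrix inverses: increasing varsigma or sigma increases G, which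
   bounds Xi(x_p, .) - Pd by a quadratic to the right of p, and since the
   two-sided derivatives are assumed to exist, right slopes suffice. *)

(** * Quadratic forms of symmetric matrices and of their inverses *)

Section QuadraticForms.
Context {R : realType}.

Lemma dotvE n (u v : 'cV[R]_n) : dotv u v = \sum_i u i 0 * v i 0.
Proof. by rewrite /dotv mxE; apply: eq_bigr => i _; rewrite mxE. Qed.

Lemma dotvC n (u v : 'cV[R]_n) : dotv u v = dotv v u.
Proof. by rewrite !dotvE; apply: eq_bigr => i _; rewrite mulrC. Qed.

Lemma dotvDr n (u v w : 'cV[R]_n) : dotv u (v + w) = dotv u v + dotv u w.
Proof. by rewrite /dotv mulmxDr mxE. Qed.

Lemma dotvZr n a (u v : 'cV[R]_n) : dotv u (a *: v) = a * dotv u v.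
Proof. by rewrite /dotv -scalemxAr mxE. Qed.

Lemma dotvZl n a (u v : 'cV[R]_n) : dotv (a *: u) v = a * dotv u v.
Proof. by rewrite dotvC dotvZr dotvC. Qed.

Lemma dotvBr n (u v w : 'cV[R]_n) : dotv u (v - w) = dotv u v - dotv u w.
Proof. by rewrite -scaleN1r dotvDr dotvZr mulN1r. Qed.

Lemma dotvBl n (u v w : 'cV[R]_n) : dotv (v - w) u = dotv v u - dotv w u.
Proof. by rewrite dotvC dotvBr dotvC (dotvC u w). Qed.

Lemma dotv_mulmx m n (A : 'M[R]_(m, n)) u v :
  dotv u (A *m v) = dotv (A^T *m u) v.
Proof. by rewrite /dotv trmx_mul trmxK mulmxA. Qed.

Lemma enorm_sqr n (x : 'cV[R]_n) : enorm x ^+ 2 = dotv x x.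
Proof.
rewrite sqr_sqrtr ?sumr_ge0 // => [|i _]; last exact: sqr_ge0.
by rewrite dotvE; apply: eq_bigr => i _; rewrite expr2.
Qed.

Lemma quadfD n (A C : 'M[R]_n) x : quadf (A + C) x = quadf A x + quadf C x.
Proof. by rewrite /quadf mulmxDl dotvDr. Qed.

Lemma quadfZ n a (A : 'M[R]_n) x : quadf (a *: A) x = a * quadf A x.
Proof. by rewrite /quadf -scalemxAl dotvZr. Qed.

Lemma quadfN n (A : 'M[R]_n) x : quadf (- A) x = - quadf A x.
Proof. by rewrite -scaleN1r quadfZ mulN1r. Qed.

Lemma quadfZv n (A : 'M[R]_n) a x : quadf A (a *: x) = a ^+ 2 * quadf A x.
Proof. by rewrite /quadf -scalemxAr dotvZr dotvZl mulrA expr2. Qed.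

Lemma quadf_gram m n (B : 'M[R]_(m, n)) x :
  quadf (B^T *m B) x = enorm (B *m x) ^+ 2.
Proof. by rewrite /quadf -mulmxA dotv_mulmx trmxK enorm_sqr. Qed.

Lemma quadf0v n (A : 'M[R]_n) : quadf A 0 = 0.
Proof. by rewrite /quadf /dotv trmx0 mul0mx mxE. Qed.

Lemma posdef_ge0 n (A : 'M[R]_n) x : posdef A -> 0 <= quadf A x.
Proof.
by move=> pA; have [->|/pA/ltW//] := eqVneq x 0; rewrite quadf0v.
Qed.

Lemma negdef_le0 n (A : 'M[R]_n) x : negdef A -> quadf A x <= 0.
Proof.
by move=> nA; have [->|/nA/ltW//] := eqVneq x 0; rewrite quadf0v.
Qed.

(** A nonzero vector in the kernel would make the form vanish. *)
Lemma posdef_unitmx n (A : 'M[R]_n) : posdef A -> A \in unitmx.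
Proof.
move=> pA; rewrite unitmxE unitfE; apply/negP => /det0P[v v0 vA].
have := pA v^T; rewrite trmx_eq0 => /(_ v0).
by rewrite /quadf /dotv trmxK mulmxA vA mul0mx mxE ltxx.
Qed.

Lemma symmetricmx_tr n (A : 'M[R]_n) : A \is symmetricmx -> A^T = A.
Proof.
by move=> /is_hermitianmxP; rewrite expr0 scale1r map_mx_id // => {2}->.
Qed.

Lemma quadf_invmx n (A : 'M[R]_n) w : A^T = A -> A \in unitmx ->
  quadf (invmx A) w = quadf A (invmx A *m w).
Proof. by move=> sA uA; rewrite /quadf mulKVmx // dotvC. Qed.

(** With x0 = A^-1 w, both sides equal (x - x0)^T A (x - x0) / 2. Writing it through the residual w
    - A x leaves A^-1 as the only matrix to estimate. *)
Lemma complete_square n (A : 'M[R]_n) w x : A^T = A -> A \in unitmx ->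
  2^-1 * quadf A x - dotv w x + 2^-1 * quadf (invmx A) w
    = 2^-1 * quadf (invmx A) (w - A *m x).
Proof.
move=> sA uA; rewrite /quadf mulmxBr mulKmx // !dotvBl !dotvBr.
rewrite [dotv (A *m x) (invmx A *m w)]dotv_mulmx trmx_inv sA mulKmx //.
rewrite (dotvC x w) (dotvC (A *m x) x); lra.
Qed.

Lemma quadf_invmx_ge0 n (A : 'M[R]_n) w : A^T = A -> posdef A ->
  0 <= quadf (invmx A) w.
Proof.
by move=> sA pA; rewrite quadf_invmx ?posdef_unitmx // posdef_ge0.
Qed.

(* Both sides are values of [w |-> max_x (2 w^T x - x^T A x)]. *)
Lemma quadf_invmx_anti n (A A' : 'M[R]_n) w : A^T = A -> A'^T = A' ->
  posdef A -> (forall x, quadf A x <= quadf A' x) ->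
  quadf (invmx A') w <= quadf (invmx A) w.
Proof.
move=> sA sA' pA leA.
have pA' : posdef A' by move=> x x0; exact: lt_le_trans (pA x x0) (leA x).
set y := invmx A' *m w.
have := complete_square w y sA (posdef_unitmx pA).
have := quadf_invmx_ge0 (w - A *m y) sA pA.
have := leA y; have := quadf_invmx w sA' (posdef_unitmx pA').
rewrite -/y -[dotv w y]/(quadf (invmx A') w); lra.
Qed.

(* Perturbing a positive definite matrix by a positive semidefinite one cannot
   enlarge its inverse, so the gap is quadratic in [t] with no appeal to the
   continuity of matrix inversion. *)
Lemma gap_quadratic n (A D : 'M[R]_n) w v t (x := invmx A *m w) :
  A^T = A -> D^T = D -> posdef A -> (forall x, 0 <= quadf D x) -> 0 <= t ->
  0 <= 2^-1 * quadf (A + t *: D) x - dotv (w + t *: v) x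
       + 2^-1 * quadf (invmx (A + t *: D)) (w + t *: v)
    <= t ^+ 2 * (2^-1 * quadf (invmx A) (v - D *m x)).
Proof.
move=> sA sD pA D0 t0.
have leA y : quadf A y <= quadf (A + t *: D) y.
  by rewrite quadfD quadfZ lerDl mulr_ge0.
have pA' : posdef (A + t *: D).
  by move=> y y0; exact: lt_le_trans (pA y y0) (leA y).
have sA' : (A + t *: D)^T = A + t *: D by rewrite linearD linearZ /= sA sD.
rewrite complete_square ?posdef_unitmx //.
(* As [x] solves A x = w, the residual of the perturbed system is linear in [t]; this is the source
   of the factor t^2. *)
have -> : w + t *: v - (A + t *: D) *m x = t *: (v - D *m x).
  rewrite mulmxDl mulKVmx ?posdef_unitmx // -scalemxAl scalerBr.
  by rewrite opprD addrACA subrr add0r.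
rewrite quadfZv mulrCA; apply/andP; split.
  by rewrite !mulr_ge0 ?sqr_ge0 ?invr_ge0 ?ler0n ?quadf_invmx_ge0.
rewrite !ler_wpM2l ?sqr_ge0 ?invr_ge0 ?ler0n //; exact: quadf_invmx_anti.
Qed.

End QuadraticForms.

(** For t > 0 the hypothesis puts the difference quotient within K t of [a], while existence of the
    derivative makes it tend to [d]. *)
Lemma is_derive_right_slope (R : realType) (F : R -> R) (s d a K : R) :
  is_derive s (1 : R) F d ->
  (forall t, 0 <= t -> `|F (s + t) - F s - a * t| <= K * t ^+ 2) ->
  a = d.
Proof.
move=> [dF vF] HF; apply/eqP; rewrite -subr_eq0 -normr_le0.
apply/ler_addgt0Pl => e e0; rewrite addr0.
have e20 : 0 < e / 2 by rewrite divr_gt0.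
have qd : (h^-1 *: ((F \o shift s) (h *: (1 : R)) - F s)
    @[h --> (0 : R)^'] --> d)%classic.
  by rewrite -vF.
(* Steps below this bound give K h <= e / 2; [|K| + 1] is positive whatever the sign of [K]. *)
have K0 : 0 < e / 2 / (`|K| + 1) by rewrite divr_gt0 // ltr_wpDl.
near ((0 : R)^'+)%classic => h.
have h0 : 0 < h by near: h; exact: nbhs_right_gt.
have hK : h <= e / 2 / (`|K| + 1) by near: h; exact: nbhs_right_le.
have qh : `|d - h^-1 *: ((F \o shift s) (h *: (1 : R)) - F s)| < e / 2.
  by near: h; have /cvgrPdist_lt := cvg_dnbhs_at_right qd; exact.
move: qh; set q := _ *: _ => qh.
have aq : `|q - a| <= e / 2.
  have := HF h (ltW h0).
  have -> : F (s + h) - F s - a * h = h * (q - a).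
    rewrite /q /= [h *: 1]mulr1 (addrC h) mulrBr [_ *: _]/(_ * _).
    by rewrite mulVKf ?gt_eqF // (mulrC a).
  rewrite normrM gtr0_norm // expr2 mulrCA ler_pM2l // => /le_trans -> //.
  have Kn : K <= `|K| + 1 by have := ler_norm K; lra.
  apply: le_trans (ler_wpM2r (ltW h0) Kn) _.
  by rewrite mulrC -ler_pdivlMr // ltr_wpDl.
have -> : a - d = - (q - a) - (d - q) by ring.
rewrite (le_trans (ler_normB _ _)) // normrN; lra.
Unshelve. all: by end_near.
Qed.

(** * The Lagrangian and weak duality *)

Section Duality.
Context {R : realType} (n m : nat).
Variables (B : 'M[R]_(m, n)) (Q H : 'M[R]_n) (lambda : R) (f b : 'cV[R]_n).
Variable mu : R.
Hypotheses (Q_sym : Q^T = Q) (H_sym : H^T = H) (H_neg : negdef H).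
Hypothesis mu_gt0 : 0 < mu.

Local Notation G := (Gmx B Q H mu).
Local Notation Pd := (dual B Q H lambda f b mu).
Local Notation P := (primal B Q lambda f mu).
Local Notation S := (dual_feasible B Q H lambda mu).

Definition lagrangian (x : 'cV[R]_n) (p : R * R) : R :=
  2^-1 * quadf (G p) x - dotv (f - p.2 *: b) x
  - mu * lambda * p.1 - mu / 2 * p.1 ^+ 2 + p.2 / mu.

Lemma Gmx_sym p : (G p)^T = G p.
Proof.
by rewrite /Gmx linearB linearD !linearZ /= trmx_mul trmxK Q_sym H_sym.
Qed.

(** With e = |Bx|^2/2 - lambda, the Lagrangian has mu (varsigma e - varsigma^2/2) in place of mu
    e^2/2; the final square is this Fenchel-Young defect. Both corrections to P(x) are nonpositive
    when x is feasible and sigma >= 0. *)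
Lemma lagrangianE x p : lagrangian x p =
  P x + p.2 * (mu^-1 - hfun H b x)
  - mu / 2 * (2^-1 * enorm (B *m x) ^+ 2 - lambda - p.1) ^+ 2.
Proof.
rewrite /lagrangian /primal /gfun /hfun /Gmx !quadfD quadfN !quadfZ quadf_gram.
rewrite dotvBl dotvZl; field; exact: lt0r_neq0.
Qed.

Lemma lagrangian_gap x p : lagrangian x p - Pd p =
  2^-1 * quadf (G p) x - dotv (f - p.2 *: b) x
  + 2^-1 * quadf (invmx (G p)) (f - p.2 *: b).
Proof. rewrite /lagrangian /dual; ring. Qed.

Lemma dual_le_lagrangian x p : S p -> Pd p <= lagrangian x p.
Proof.
move=> [_ _ pG]; rewrite -subr_ge0 lagrangian_gap.
rewrite complete_square ?Gmx_sym ?posdef_unitmx //.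
by rewrite mulr_ge0 ?invr_ge0 ?ler0n ?quadf_invmx_ge0 ?Gmx_sym.
Qed.

Lemma dual_eq_lagrangian p : S p ->
  lagrangian (dual_to_primal B Q H f b mu p) p = Pd p.
Proof.
move=> [_ _ pG]; apply/eqP; rewrite -subr_eq0 lagrangian_gap.
rewrite complete_square ?Gmx_sym ?posdef_unitmx //.
by rewrite mulKVmx ?posdef_unitmx // subrr quadf0v mulr0.
Qed.

Lemma weak_duality x p : feasible H b mu x -> S p -> Pd p <= P x.
Proof.
move=> Xx Sp; apply: le_trans (dual_le_lagrangian x Sp) _.
rewrite lagrangianE -addrA gerDl subr_le0.
have [_ p20 _] := Sp.
rewrite (@le_trans _ _ 0) ?mulr_ge0_le0 ?subr_le0 //.
by rewrite mulr_ge0 ?sqr_ge0 ?divr_ge0 ?ler0n ?ltW.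
Qed.

(** * Consequences of the vanishing of the partial derivatives *)

Section CriticalPoint.
Variable p : R * R.
Hypothesis Sp : S p.
Let x := dual_to_primal B Q H f b mu p.

Lemma critical_varsigma : is_derive p.1 (1 : R) (fun s => Pd (s, p.2)) 0 ->
  2^-1 * enorm (B *m x) ^+ 2 - lambda - p.1 = 0.
Proof.
have [_ _ pG] := Sp => dF.
(* Multiplied by [mu], the left side is the partial derivative of the Lagrangian in varsigma. *)
apply: (mulfI (lt0r_neq0 mu_gt0)); rewrite mulr0.
set D := mu *: (B^T *m B); set C := 2^-1 * quadf (invmx (G p)) (0 - D *m x).
(* [C] bounds the duality gap at [x]; [mu / 2] comes from the term of the Lagrangian quadratic in
   varsigma. *)
apply: (@is_derive_right_slope _ _ _ _ _ (C + mu / 2) dF) => t t0.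
have sD : D^T = D by rewrite linearZ /= trmx_mul trmxK.
have D0 y : 0 <= quadf D y.
  by rewrite quadfZ quadf_gram mulr_ge0 ?sqr_ge0 ?ltW.
have := gap_quadratic (f - p.2 *: b) 0 (Gmx_sym p) sD pG D0 t0.
rewrite -/(dual_to_primal B Q H f b mu p) -/x -/C scaler0 addr0.
have -> : G p + t *: D = G (p.1 + t, p.2).
  by rewrite /Gmx /= mulrDr scalerDl scalerA (mulrC t) addrAC addrA.
rewrite -(lagrangian_gap x (p.1 + t, p.2)) -surjective_pairing.
rewrite -(dual_eq_lagrangian Sp) -/x !lagrangianE /=.
have mut : 0 <= mu * t ^+ 2 by rewrite mulr_ge0 ?sqr_ge0 ?ltW.
move: C (Pd _) (P x) (_ - hfun H b x) (2^-1 * enorm _ ^+ 2) => {D sD D0}.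
move=> C u Px hx e /andP[lo hi].
rewrite ler_norml; apply/andP; split; lra.
Qed.

Lemma critical_sigma : is_derive p.2 (1 : R) (fun t => Pd (p.1, t)) 0 ->
  hfun H b x = mu^-1.
Proof.
have [_ _ pG] := Sp => dF.
apply/eqP; rewrite eq_sym -subr_eq0; apply/eqP.
set C := 2^-1 * quadf (invmx (G p)) (- b - - H *m x).
(* The Lagrangian is affine in sigma with slope 1/mu - h(x), so only the gap contributes to the
   constant. *)
apply: (@is_derive_right_slope _ _ _ _ _ C dF) => t t0.
have sD : (- H)^T = - H by rewrite linearN /= H_sym.
have D0 y : 0 <= quadf (- H) y by rewrite quadfN oppr_ge0 negdef_le0.
have := gap_quadratic (f - p.2 *: b) (- b) (Gmx_sym p) sD pG D0 t0.
rewrite -/(dual_to_primal B Q H f b mu p) -/x -/C.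
have -> : G p + t *: - H = G (p.1, p.2 + t).
  by rewrite /Gmx /= scalerDl scalerN opprD addrA.
have -> : f - p.2 *: b + t *: - b = f - (p.2 + t) *: b.
  by rewrite scalerDl scalerN opprD addrA.
rewrite -(lagrangian_gap x (p.1, p.2 + t)) -surjective_pairing.
rewrite -(dual_eq_lagrangian Sp) -/x !lagrangianE /=.
move: C (Pd _) (P x) (_ - hfun H b x) (_ ^+ 2) => {D0}.
move=> C u Px hx e /andP[lo hi].
have Ct : 0 <= t ^+ 2 * C := le_trans lo hi.
rewrite ler_norml; apply/andP; split; lra.
Qed.

End CriticalPoint.
End Duality.

Theorem theorem2 (R : realType) (n m : nat) (n_gt0 : (0 < n)%N)
    (m_gt0 : (0 < m)%N) (B : 'M[R]_(m, n)) (Q H : 'M[R]_n) (lambda : R)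
    (f b : 'cV[R]_n) (delta mu : R) (varsigma sigma : R)
    (Q_sym : Q \is symmetricmx) (H_sym : H \is symmetricmx) (H_neg : negdef H)
    (lambda_gt0 : 0 < lambda)
    (h_gt0 : 0 < hfun H b (invmx H *m b))
    (delta_bounds : 0 < delta <= (mu_zero H b)^-1)
    (mu_bounds : mu_zero H b <= mu <= delta^-1)
    (crit : critical_point_over (dual B Q H lambda f b mu)
              (dual_feasible B Q H lambda mu) (varsigma, sigma)) :
  let P := primal B Q lambda f mu in
  let X := feasible H b mu in
  let Pd := dual B Q H lambda f b mu in
  let S := dual_feasible B Q H lambda mu in
  let x := dual_to_primal B Q H f b mu (varsigma, sigma) in
  [/\ global_minimizer P X x,
      global_maximizer Pd S (varsigma, sigma),
      is_min_value P X (P x),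
      P x = Pd (varsigma, sigma) &
      is_max_value Pd S (Pd (varsigma, sigma))].
Proof.
move=> P X Pd S x.
have [Sp d1 d2] := crit.
have mu_gt0 : 0 < mu.
  by have /andP[+ _] := mu_bounds; apply: lt_le_trans; rewrite invr_gt0.
have sQ := symmetricmx_tr Q_sym; have sH := symmetricmx_tr H_sym.
have hx : hfun H b x = mu^-1 by apply: critical_sigma d2.
have ex := critical_varsigma sQ sH mu_gt0 Sp d1.
have Xx : X x by rewrite /X /feasible /= hx.
(* Both corrections in [lagrangianE] vanish at [x], which closes the duality gap. *)
have PxE : P x = Pd (varsigma, sigma).
  rewrite /Pd -(dual_eq_lagrangian _ _ sQ sH Sp) lagrangianE //.
  by rewrite -/x hx ex subrr expr0n /= !mulr0 addr0 subr0.
(* Weak duality is used twice: against the fixed dual point here, then against the fixed [x] for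
   maximality. *)
have minP y : X y -> P x <= P y.
  by move=> Xy; rewrite PxE; exact: (weak_duality f sQ sH mu_gt0 Xy Sp).
have maxPd q : S q -> Pd q <= Pd (varsigma, sigma).
  by move=> Sq; rewrite -PxE; exact: (weak_duality f sQ sH mu_gt0 Xx Sq).
split=> //; split=> //.
- by move=> _ [y Xy <-]; exact: minP.
- by move=> _ [q Sq <-]; exact: maxPd.
Qed.
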